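(* Let $\mathcal L$ be a countable language, $T$ a complete $\mathcal L$-theory with monster model $\mathcal U$, $M\prec\mathcal U$ small, and $\mu\in\mathfrak{M}_x^{\mathrm{inv}}(\mathcal{U},M)$. If $\mu$ is fim over $M$, then $\mathbb{P}_\mu(\mathbf{O})=\mathbb{P}_\mu(\mathbf{I})=\mathbb{P}_\mu(\mathbf{L})=0$.
   Context: Keisler measures: $S_x(A)$ is the Stone space of complete types over $A$; a Keisler measure is a finitely additive probability measure on $\mathcal L(A)$-formulas in $x$, identified with its regular Borel extension to $S_x(A)$; $[\varphi]$ is the clopen set of types containing $\varphi$. $\mu\in\mathfrak M_x(\mathcal U)$ is $M$-invariant if $\mu(\varphi(x,a))=\mu(\varphi(x,b))$ for all $\mathcal L$-formulas $\varphi(x,y)$ and $a\equiv_M b$; these form $\mathfrak M^{\mathrm{inv}}_x(\mathcal U,M)$. For small $N'\supseteq M$ and an $\mathcal L(N')$-formula $\varphi(x,y)$, $F^\varphi_{\mu,N'}:S_y(N')\to[0,1]$, $q\mapsto\mu(\varphi(x,b))$, $b\models q$. $\mu$ is definable over $M$ if all $F^\varphi_{\mu,M}$ ($\varphi$ an $\mathcal L$-formula) are continuous. Morley product: $(\mu\otimes\nu)(\varphi(x,y))=\int_{S_y(N')}F^\varphi_{\mu,N'}\,d(\nu|_{N'})$. $\mu^{(1)}=\mu(x_1)$, $\mu^{(n+1)}=\mu(x_{n+1})\otimes\mu^{(n)}(x_1,\dots,x_n)$. $\mathbb P_\mu$ is the regular Borel probability measure on $S_{\mathbf x}(\mathcal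 U)$, $\mathbf x=(x_i)_{i\ge1}$, with $\mathbb P_\mu([\varphi(x_1,\dots,x_n)])=\mu^{(n)}(\varphi(x_1,\dots,x_n))$. fim: $\mu$ is fim over $M$ if it is definable over $M$ and for each $\mathcal L$-formula $\varphi(x,y)$ there are $\mathcal L(M)$-formulas $\theta_n(x_1,\dots,x_n)$ ($n\ge1$) such that (i) for every $\epsilon>0$ there is $n_\epsilon$ with: if $n>n_\epsilon$ and $\mathcal U\models\theta_n(a_1,\dots,a_n)$ then $\sup_{b}|\mu(\varphi(x,b))-\frac1n|\{i:\models\varphi(a_i,b)\}||<\epsilon$; (ii) $\lim_n\mu^{(n)}(\theta_n(x_1,\dots,x_n))=1$. Dividing-line events: for a formula $\varphi(x,y)$, $O^\varphi_n(x_1,\dots,x_n)=\exists y_1\dots y_n(\bigwedge_{1\le i\le j\le n}\varphi(x_i,y_j)\wedge\bigwedge_{1\le j<i\le n}\neg\varphi(x_i,y_j))$; $I^\varphi_n(x_1,\dots,x_n)$ says that for every $K\subseteq\{1,\dots,n\}$ there is $y_K$ with $\varphi(x_i,y_K)$ for $i\in K$ and $\neg\varphi(x_i,y_K)$ for $i\notin K$; $L^\varphi_n(x_1,\dots,x_n)$ says $\varphi(x_1,\mathcal U)\subsetneq\varphi(x_2,\mathcal U)\subsetneq\dots\subsetneq\varphi(x_n,\mathcal U)$. $\mathbf O^\varphi=\bigcap_n[O^\varphi_n(x_1,\dots,x_n)]$, $\mathbf I^\varphi=\bigcap_n[I^\varphi_n(x_1,\dots,x_n)]$, $\mathbf L^\varphi=\bigcap_n[L^\varphi_n(x_1,\dots,x_n)]$,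 and $\mathbf O=\bigcup_{\varphi}\mathbf O^\varphi$, $\mathbf I=\bigcup_\varphi\mathbf I^\varphi$, $\mathbf L=\bigcup_\varphi\mathbf L^\varphi$, unions over all $\mathcal L$-formulas $\varphi(x,y)$. *)

(* Defs.v *)
From HB Require Import structures.
From mathcomp Require Import all_boot all_order all_algebra.
From mathcomp Require Import all_classical all_reals all_analysis.
Set Implicit Arguments.
Unset Strict Implicit.
Unset Printing Implicit Defensive.
Import Order.TTheory GRing.Theory Num.Theory.
Import numFieldNormedType.Exports.
Local Open Scope classical_set_scope.
Local Open Scope ring_scope.

Record language := Language {
  fsym : Type;
  far : fsym -> nat;
  rsym : Type;
  rar : rsym -> nat }.

Definition countable_language (L : language) : Prop :=
  countable [set: fsym L] /\ countable [set: rsym L].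

Inductive term (L : language) (V : Type) : Type :=
| Var of V
| App (f : fsym L) of ('I_(far f) -> term L V).

(* Formulas are well scoped: [formula L V] is the type of formulas whose free
   variables are among V, and [FEx] binds the variable [None]. *)
Inductive formula (L : language) (V : Type) : Type :=
| FTrue
| FEq of term L V & term L V
| FRel (r : rsym L) of ('I_(rar r) -> term L V)
| FNot of formula L V
| FAnd of formula L V & formula L V
| FEx of formula L (option V).

Arguments Var {L V}.
Arguments App {L V}.
Arguments FTrue {L V}.
Arguments FEq {L V}.
Arguments FRel {L V}.
Arguments FNot {L V}.
Arguments FAnd {L V}.
Arguments FEx {L V}.

Definition FOr (L : language) (V : Type) (f g : formula L V) :=
  FNot (FAnd (FNot f) (FNot g)).

Definition FImp (L : language) (V : Type) (f g : formula L V) :=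
  FNot (FAnd f (FNot g)).

Fixpoint tmap (L : language) (V W : Type) (h : V -> W) (t : term L V) :
    term L W :=
  match t with
  | Var v => Var (h v)
  | App f ts => App f (fun i => tmap h (ts i))
  end.

Fixpoint fmap (L : language) (V W : Type) (h : V -> W) (f : formula L V) :
    formula L W :=
  match f with
  | FTrue => FTrue
  | FEq t u => FEq (tmap h t) (tmap h u)
  | FRel r ts => FRel r (fun i => tmap h (ts i))
  | FNot g => FNot (fmap h g)
  | FAnd g1 g2 => FAnd (fmap h g1) (fmap h g2)
  | FEx g => FEx (fmap (omap h) g)
  end.

Record structure (L : language) (D : Type) := Structure {
  fint : forall f : fsym L, ('I_(far f) -> D) -> D;
  rint : forall r : rsym L, ('I_(rar r) -> D) -> Prop }.

Fixpoint teval (L : language) (D : Type) (S : structure L D) (V : Type)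
    (e : V -> D) (t : term L V) : D :=
  match t with
  | Var v => e v
  | App f ts => fint S (fun i => teval S e (ts i))
  end.

Fixpoint sat (L : language) (D : Type) (S : structure L D) (V : Type)
    (f : formula L V) (e : V -> D) : Prop :=
  match f with
  | FTrue => True
  | FEq t u => teval S e t = teval S e u
  | FRel r ts => rint S (fun i => teval S e (ts i))
  | FNot g => ~ sat S g e
  | FAnd g1 g2 => sat S g1 e /\ sat S g2 e
  | FEx g => exists a : D, sat S g (oapp e a)
  end.

Lemma teval_tmap (L : language) (D : Type) (S : structure L D) (V W : Type)
    (h : V -> W) (e : W -> D)
    (t : term L V) : teval S e (tmap h t) = teval S (e \o h) t.
Proof.
elim: t => [//|f ts IH] /=; congr fint; apply/funext => i; exact: IH.
Qed.

Lemma sat_fmap (L : language) (D : Type) (S : structure L D) (V W : Type)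
    (h : V -> W) (f : formula L V)
    (e : W -> D) : sat S (fmap h f) e <-> sat S f (e \o h).
Proof.
elim: f W h e => {V} [V|V t u|V r ts|V g IH|V g1 IH1 g2 IH2|V g IH] W h e //=.
- by rewrite !teval_tmap.
- suff -> : (fun i => teval S e (tmap h (ts i))) =
            (fun i => teval S (e \o h) (ts i)) by [].
  by apply/funext => i; rewrite teval_tmap.
- by rewrite IH.
- by rewrite IH1 IH2.
- by split=> -[a ha]; exists a; move: ha; rewrite IH;
    (have -> : oapp e a \o omap h = oapp (e \o h) a by apply/funext; case).
Qed.

Definition sum0 (V : Type) (v : V + 'I_0) : V :=
  match v with inl x => x | inr (Ordinal _ h) => match notF h with end end.

Definition sumS (V : Type) k (v : V + 'I_k.+1) : option (V + 'I_k) :=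
  match v with
  | inl x => Some (inl x)
  | inr i => omap inr (unlift ord_max i)
  end.

Fixpoint FExn (L : language) (V : Type) (k : nat) :
    formula L (V + 'I_k) -> formula L V :=
  match k with
  | 0%N => fmap (@sum0 V)
  | k'.+1 => fun f => FExn (FEx (fmap (@sumS V k') f))
  end.

Definition FExs (L : language) (V : Type) (F : finType)
    (f : formula L (V + F)) : formula L V :=
  FExn (fmap (fun v => match v with
                       | inl x => inl x
                       | inr y => inr (enum_rank y)
                       end) f).

Definition FAlls (L : language) (V : Type) (F : finType)
    (f : formula L (V + F)) : formula L V :=
  FNot (FExs (FNot f)).

Definition vpair (D V W : Type) (a : V -> D) (b : W -> D) : V + W -> D :=
  fun v => match v with inl x => a x | inr y => b y end.

Lemma sat_FExn (L : language) (D : Type) (S : structure L D) (V : Type) k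
    (f : formula L (V + 'I_k))
    (e : V -> D) :
  sat S (FExn f) e <-> exists b : 'I_k -> D, sat S f (vpair e b).
Proof.
elim: k f => [|k IH] f /=.
  have sum0E (b : 'I_0 -> D) : e \o @sum0 V = vpair e b.
    by apply/funext => -[//|[]].
  rewrite sat_fmap; split=> [h|[b]]; last by rewrite (sum0E b).
  have b0 (i : 'I_0) : D by case: i.
  by exists b0; rewrite -(sum0E b0).
rewrite IH; split=> -[b].
  move=> /= [a]; rewrite sat_fmap => h.
  exists (fun i => oapp b a (unlift ord_max i)).
  congr (sat S f _): h; apply/funext => -[//|i] /=.
  by case: (unlift ord_max i).
move=> h; exists (fun i => b (lift ord_max i)) => /=; exists (b ord_max).
rewrite sat_fmap; congr (sat S f _): h; apply/funext => -[//|i] /=.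
by case: unliftP => [j|] ->.
Qed.

Lemma sat_FExs (L : language) (D : Type) (S : structure L D) (V : Type)
    (F : finType) (f : formula L (V + F))
    (e : V -> D) :
  sat S (FExs f) e <-> exists b : F -> D, sat S f (vpair e b).
Proof.
rewrite sat_FExn; split=> -[b]; last first.
  move=> h; exists (b \o enum_val); rewrite sat_fmap.
  by congr (sat S f _): h; apply/funext => -[//|y] /=; rewrite enum_rankK.
rewrite sat_fmap => h; exists (b \o enum_rank).
by congr (sat S f _): h; apply/funext => -[].
Qed.

Lemma sat_bigand (L : language) (D : Type) (S : structure L D) (V : Type)
    (I : finType) (P : pred I)
    (F : I -> formula L V) (e : V -> D) :
  sat S (\big[FAnd/FTrue]_(i | P i) F i) e <-> forall i, P i -> sat S (F i) e.
Proof.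
suff H s : sat S (\big[FAnd/FTrue]_(i <- s | P i) F i) e <->
    forall i, i \in s -> P i -> sat S (F i) e.
  by rewrite H; split=> h i => [Pi|_]; apply: h; rewrite ?mem_index_enum.
elim: s => [|j s IH]; first by rewrite big_nil.
rewrite big_cons; case: ifPn => Pj /=; rewrite IH; split.
- by move=> [hj hs] i; rewrite in_cons => /orP[/eqP ->//|]; exact: hs.
- by move=> h; split=> [|i si]; apply: h; rewrite ?in_cons ?eqxx ?si ?orbT.
- move=> hs i; rewrite in_cons => /orP[/eqP -> hj|]; last exact: hs.
  by rewrite hj in Pj.
- by move=> h i si; apply: h; rewrite ?in_cons si orbT.
Qed.

Definition sentence (L : language) := formula L void.

Definition models (L : language) (D : Type) (S : structure L D)
    (T : set (sentence L)) : Prop :=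
  forall f, T f -> sat S f (of_void D).

Definition entails (L : language) (T : set (sentence L)) (f : sentence L) :
    Prop :=
  forall (D : pointedType) (S : structure L D),
    models S T -> sat S f (of_void D).

Definition complete_theory (L : language) (T : set (sentence L)) : Prop :=
  (exists (D : pointedType) (S : structure L D), models S T) /\
  forall f, entails T f \/ entails T (FNot f).

Definition elementary_substructure (L : language) (U : Type)
    (S : structure L U) (M : set U) : Prop :=
  M !=set0 /\
  exists N : structure L M, forall n (f : formula L 'I_n) (e : 'I_n -> M),
    sat N f e <-> sat S f (val \o e).

Definition automorphism (L : language) (U : Type) (S : structure L U)
    (s : U -> U) : Prop :=
  [/\ bijective s,
      forall (f : fsym L) a, s (fint S a) = fint S (s \o a :> ('I_(far f) -> U))
    & forall (r : rsym L) a, rint S (s \o a :> ('I_(rar r) -> U)) <-> rint S a].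

(* An L(A)-formula in the variables V. The constant naming an element of A is
   encoded as a free variable which is always interpreted by that element. *)
Definition lform (L : language) (U : Type) (A : set U) (V : Type) :=
  formula L (V + A).

Definition inT (U : Type) (u : U) : [set: U] :=
  SigSub (mem_set (I : [set: U] u)).

Section Params.
Context (L : language) (U : Type) (S : structure L U).

Definition psat (A : set U) (V : Type) (f : lform L A V) (e : V -> U) : Prop :=
  sat S f (vpair e val).

Definition ofL (A : set U) (V : Type) (f : formula L V) : lform L A V :=
  fmap inl f.

Definition prename (A : set U) (V W : Type) (h : V -> W) (f : lform L A V) :
    lform L A W :=
  fmap (fun v => match v with inl x => inl (h x) | inr a => inr a end) f.

Definition toU (A : set U) (V : Type) (f : lform L A V) : lform L [set: U] V :=
  fmap (fun v => match v with
                 | inl x => inl x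
                 | inr a => inr (inT (val a))
                 end) f.

(* [inst f b] is f(x,b), for f(x,y) an L(A)-formula and b a tuple from U *)
Definition inst (A : set U) (V W : Type) (f : lform L A (V + W)) (b : W -> U) :
    lform L [set: U] V :=
  fmap (fun v => match v with
                 | inl (inl x) => inl x
                 | inl (inr y) => inr (inT (b y))
                 | inr a => inr (inT (val a))
                 end) f.

Definition same_type (A : set U) (W : Type) (a b : W -> U) : Prop :=
  forall f : lform L A W, psat f a <-> psat f b.

(* Complete types over A, consistency being finite satisfiability in U *)
Definition complete_type (A : set U) (V : Type) (p : set (lform L A V)) :
    Prop :=
  (forall F : set (lform L A V), finite_set F -> F `<=` p ->
     exists e : V -> U, forall f, F f -> psat f e) /\
  forall f, p f \/ p (FNot f).

End Params.

Section Stone.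
Context (L : language) (U : pointedType) (S : structure L U).

Record stone (A : set U) (V : Type) := Stone {
  in_type : set (lform L A V);
  stoneP : complete_type S in_type }.

Definition basic A (V : Type) (f : lform L A V) : set (stone A V) :=
  [set p | in_type p f].

Definition realizes A (V : Type) (b : V -> U) (p : stone A V) : Prop :=
  forall f, in_type p f -> psat S f b.

Lemma type_of_complete A (V : Type) (b : V -> U) :
  complete_type S [set f : lform L A V | psat S f b].
Proof. by split=> [F _ Fp|f]; [exists b | exact: EM]. Qed.

Definition type_of A (V : Type) (b : V -> U) : stone A V :=
  Stone (@type_of_complete A V b).

Section Topology.
Context (A : set U) (V : Type).

HB.instance Definition _ := gen_eqMixin (stone A V).
HB.instance Definition _ := gen_choiceMixin (stone A V).
HB.instance Definition _ := isPointed.Build (stone A V) (type_of A (fun=> point)).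

Definition stone_open : set_system (stone A V) :=
  [set O | forall p, O p -> exists2 f, basic f p & basic f `<=` O].

Lemma stone_sat3 (p : stone A V) (f g h : lform L A V) :
  in_type p f -> in_type p g -> in_type p h ->
  exists e, [/\ psat S f e, psat S g e & psat S h e].
Proof.
move=> pf pg ph.
have [||e he] := (stoneP p).1 ([set f] `|` [set g] `|` [set h]).
- by rewrite !finite_setU; split; [split|]; exact: finite_set1.
- by move=> _ [[->|->]|->].
- by exists e; split; apply: he; [left; left|left; right|right].
Qed.

Lemma basic_and (f g : lform L A V) :
  basic (FAnd f g) = basic f `&` basic g.
Proof.
apply/seteqP; split=> p /=; rewrite /basic /=.
  move=> pfg; split.
    have [//|nf] := (stoneP p).2 f.
    by have [e [[ef _] /(_ ef)]] := stone_sat3 pfg nf nf.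
  have [//|ng] := (stoneP p).2 g.
  by have [e [[_ eg] /(_ eg)]] := stone_sat3 pfg ng ng.
move=> [pf pg]; have [//|nfg] := (stoneP p).2 (FAnd f g).
by have [e [ef eg []]] := stone_sat3 pf pg nfg.
Qed.

Lemma stone_openT : stone_open setT.
Proof.
move=> p _; exists FTrue => //; have [//|nt] := (stoneP p).2 FTrue.
by have [e [/(_ I)]] := stone_sat3 nt nt nt.
Qed.

Lemma stone_openI : setI_closed stone_open.
Proof.
move=> O1 O2 o1 o2 p [/o1[f pf fO] /o2[g pg gO]].
exists (FAnd f g); rewrite basic_and//.
by move=> q [qf qg]; split; [exact: fO | exact: gO].
Qed.

Lemma stone_open_bigU (I : Type) (F : I -> set (stone A V)) :
  (forall i, stone_open (F i)) -> stone_open (\bigcup_i F i).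
Proof.
move=> oF p [i _ /oF[f pf fF]]; exists f => // q /fF ?; by exists i.
Qed.

HB.instance Definition _ := isOpenTopological.Build (stone A V)
  stone_openT stone_openI stone_open_bigU.

End Topology.

Definition borel_stone A (V : Type) := g_sigma_algebraType (@open (stone A V)).

Context (R : realType).

Definition regular A (V : Type) (P : probability (borel_stone A V) R) : Prop :=
  forall B : set (borel_stone A V), measurable B ->
    P B = ereal_inf [set P O |
      O in [set O : set (stone A V) | open O /\ B `<=` O]] /\
    P B = ereal_sup [set P C |
      C in [set C : set (stone A V) | compact C /\ C `<=` B]].

(* Real-valued functions m on L(A)-formulas in the variables V; the last two
   fields are finite additivity and invariance under equivalence in U. *)
Record keisler A (V : Type) (m : lform L A V -> R) : Prop := Keisler {
  keisler_ge0 : forall f, 0 <= m f;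
  keisler1 : m FTrue = 1;
  keislerU : forall f g, (forall e, ~ (psat S f e /\ psat S g e)) ->
    m (FOr f g) = m f + m g;
  keisler_ext : forall f g, (forall e, psat S f e <-> psat S g e) -> m f = m g }.

(* The regular Borel extension of a Keisler measure m over A to S_V(A). It
   exists and is unique; the Dirac measure is only there to make the definition
   total. *)
Definition borel_ext A (V : Type) (m : lform L A V -> R) :
    probability (borel_stone A V) R :=
  xget (dirac (point : borel_stone A V) : probability (borel_stone A V) R)
    [set P | regular P /\ forall f, P (basic f) = (m f)%:E].

Definition M_invariant (M : set U) (V : Type) (m : lform L [set: U] V -> R) :
    Prop :=
  forall k (f : formula L (V + 'I_k)) (a b : 'I_k -> U),
    same_type S M a b -> m (inst (ofL M f) a) = m (inst (ofL M f) b).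

(* F^f_{m,N}(q) = m(f(x,b)) for any realization b in U of q; independent of b
   if m is M-invariant and M is included in N. *)
Definition Ffun (V : Type) (m : lform L [set: U] V -> R) N (W : Type)
    (f : lform L N (V + W)) (q : stone N W) : R :=
  xget 0 [set r | exists2 b, realizes b q & r = m (inst f b)].

Definition definable (M : set U) (V : Type) (m : lform L [set: U] V -> R) :
    Prop :=
  forall k (f : formula L (V + 'I_k)), continuous (Ffun m (ofL M f)).

End Stone.

Arguments basic {L U} S {A V} f.

Definition small (K U : Type) (A : set U) : Prop := ~ ([set: K] #<= A)%card.

(* kappa-saturation and strong kappa-homogeneity, kappa being the cardinal of K *)
Record monster (K : Type) (L : language) (U : pointedType)
    (S : structure L U) : Prop := Monster {
  monster_uncountable : ~ countable [set: K];
  monster_saturated : forall (A : set U) n (p : stone S A 'I_n), small K A ->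
    exists b, realizes b p;
  monster_homogeneous : forall (A : set U) (h : U -> U), small K A ->
    (forall n (f : formula L 'I_n) (a : 'I_n -> U), (forall i, A (a i)) ->
       sat S f a <-> sat S f (h \o a)) ->
    exists2 s, automorphism S s & {in A, s =1 h} }.

Section Morley.
Context (K : Type) (L : language) (U : pointedType) (S : structure L U).
Context (R : realType) (M : set U).

(* The Morley product of m(x) and n(y) at an L(U)-formula f(x,y), viewed as an
   L(N)-formula f' for some small N containing M; for m invariant and definable
   over M the value does not depend on N. *)
Definition morley (V W : Type) (m : lform L [set: U] V -> R)
    (n : lform L [set: U] W -> R)
    (f : lform L [set: U] (V + W)) : R :=
  xget 0 [set r | exists N : set U, [/\ M `<=` N, small K N &
    exists2 f' : lform L N (V + W), f = toU f' &
      r = \int[borel_ext S (fun g : lform L N W => n (toU g))]_q Ffun m f' q]].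

Context (d : nat).

Definition split_last n (v : 'I_n.+2 * 'I_d) : 'I_d + 'I_n.+1 * 'I_d :=
  match unlift ord_max v.1 with
  | None => inl v.2
  | Some i => inr (i, v.2)
  end.

(* [mpow m n] is m^(n+1)(x_1,...,x_{n+1}); the variable (i, j) is the j-th
   coordinate of the d-tuple x_{i+1}. *)
Fixpoint mpow (m : lform L [set: U] 'I_d -> R) (n : nat) :
    lform L [set: U] ('I_n.+1 * 'I_d) -> R :=
  match n with
  | 0%N => fun f => m (prename snd f)
  | n'.+1 => fun f => morley m (mpow m (n := n')) (prename (@split_last n') f)
  end.

(* The n-th formula theta_n of the definition is [theta n.-1]. *)
Definition fim (m : lform L [set: U] 'I_d -> R) : Prop :=
  definable S M m /\
  forall k (f : formula L ('I_d + 'I_k)),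
  exists theta : forall n, lform L M ('I_n.+1 * 'I_d),
    (forall eps : R, 0 < eps -> exists n_eps : nat, forall n, (n_eps < n.+1)%N ->
       forall a : 'I_n.+1 -> 'I_d -> U, psat S (theta n) (fun v => a v.1 v.2) ->
       sup [set `| m (inst (ofL M f) b) -
                   #|[pred i | `[< sat S f (vpair (a i) b) >] ]|%:R / n.+1%:R |
           | b in [set: 'I_k -> U]] < eps) /\
    mpow m (toU (theta n)) @[n --> \oo] --> (1 : R).

(* The variables (x_i)_{i >= 1}: (i, j) is the j-th coordinate of x_{i+1}. *)
Definition is_Pmu (m : lform L [set: U] 'I_d -> R)
    (P : probability (borel_stone S [set: U] (nat * 'I_d)) R) : Prop :=
  regular P /\
  forall n (f : lform L [set: U] ('I_n.+1 * 'I_d)),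
    P (basic S (prename (fun v => (val v.1, v.2)) f)) = (mpow m f)%:E.

End Morley.

Section DividingLines.
Context (L : language) (d k : nat) (f : formula L ('I_d + 'I_k)).

(* f(x_i, y), where y is the tuple of variables named by h *)
Definition at_x n (W : Type) (i : 'I_n) (h : 'I_k -> W) :
    formula L ('I_n * 'I_d + W) :=
  fmap (fun v => match v with inl x => inl (i, x) | inr y => inr (h y) end) f.

Definition Oform n : formula L ('I_n * 'I_d) :=
  FExs (F := ('I_n * 'I_k)%type) (FAnd
    (\big[FAnd/FTrue]_(ij : 'I_n * 'I_n | (ij.1 <= ij.2)%N) at_x ij.1 (pair ij.2))
    (\big[FAnd/FTrue]_(ij : 'I_n * 'I_n | (ij.2 < ij.1)%N)
       FNot (at_x ij.1 (pair ij.2)))).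

Definition Iform n : formula L ('I_n * 'I_d) :=
  \big[FAnd/FTrue]_(J : {set 'I_n}) FExs (F := 'I_k) (FAnd
    (\big[FAnd/FTrue]_(i : 'I_n | i \in J) at_x i id)
    (\big[FAnd/FTrue]_(i : 'I_n | i \notin J) FNot (at_x i id))).

Definition Lform n : formula L ('I_n * 'I_d) :=
  \big[FAnd/FTrue]_(ij : 'I_n * 'I_n | ij.1.+1 == ij.2 :> nat) FAnd
    (FAlls (F := 'I_k) (FImp (at_x ij.1 id) (at_x ij.2 id)))
    (FExs (F := 'I_k) (FAnd (at_x ij.2 id) (FNot (at_x ij.1 id)))).

End DividingLines.

Section Events.
Context (L : language) (U : pointedType) (S : structure L U) (d : nat).

Definition event n (f : formula L ('I_n * 'I_d)) :
    set (borel_stone S [set: U] (nat * 'I_d)) :=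
  basic S (ofL [set: U] (fmap (fun v => (val v.1, v.2)) f)).

Definition event_union
    (E : forall k, formula L ('I_d + 'I_k) -> forall n, formula L ('I_n * 'I_d)) :
    set (borel_stone S [set: U] (nat * 'I_d)) :=
  \bigcup_k \bigcup_(f : formula L ('I_d + 'I_k))
    \bigcap_(n in [set n | (0 < n)%N]) event (E k f n).

Definition boldO := event_union (fun k f => @Oform L d k f).
Definition boldI := event_union (fun k f => @Iform L d k f).
Definition boldL := event_union (fun k f => @Lform L d k f).

End Events.

Arguments boldO {L U} S d.
Arguments boldI {L U} S d.
Arguments boldL {L U} S d.

(* Main.v *)
Require Import Defs.
From mathcomp Require Import all_boot all_order all_algebra.
From mathcomp Require Import all_classical all_reals all_analysis.
From mathcomp Require Import ring lra.
Set Implicit Arguments.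
Unset Strict Implicit.
Unset Printing Implicit Defensive.
Import Order.TTheory GRing.Theory Num.Theory.
Local Open Scope classical_set_scope.
Local Open Scope ring_scope.

(** On each of the three events, for every N some instance phi(x,b) holds of all
    of x_1, ..., x_N and of none of x_(N+1), ..., x_(2N), or the other way round,
    so the frequencies of phi(x,b) along x_1, ..., x_N and along x_1, ..., x_(2N)
    differ by 1/2. If theta_N(x_1, ..., x_N) and theta_(2N)(x_1, ..., x_(2N))
    both hold and N is large, both frequencies are within 1/4 of mu(phi(x,b)), a
    contradiction. The probabilities of theta_N and theta_(2N) tend to 1, so the
    event attached to phi is null; there are countably many formulas phi. *)

(** * Countability of the set of formulas in a countable language *)

(** Finite trees labelled by naturals form a countable type. The arguments of a symbol, a function
    on an ordinal, become the list of children of a node. *)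
Fixpoint term_code (L : language) (cf : Defs.fsym L -> nat) (V : Type)
    (c : V -> nat) (t : term L V) : GenTree.tree nat :=
  match t with
  | Var v => GenTree.Leaf (c v)
  | App f ts =>
      GenTree.Node (cf f) [seq term_code cf c (ts i) | i <- enum 'I_(far f)]
  end.

Definition option_code (V : Type) (c : V -> nat) (v : option V) : nat :=
  if v is Some x then (c x).+1 else 0%N.

(** The coding [c] of variables is an argument that varies in the recursion: under a quantifier the
    new variable [None] gets code 0 and the others are shifted by one. The labels 0 to 5 separate
    the constructors. *)
Fixpoint formula_code (L : language) (cf : Defs.fsym L -> nat)
    (cr : rsym L -> nat) (V : Type) (c : V -> nat) (f : formula L V) :
    GenTree.tree nat :=
  match f with
  | FTrue => GenTree.Node 0 [::]
  | FEq t u => GenTree.Node 1 [:: term_code cf c t; term_code cf c u]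
  | FRel r ts =>
      GenTree.Node 2 (GenTree.Leaf (cr r) ::
        [seq term_code cf c (ts i) | i <- enum 'I_(rar r)])
  | FNot g => GenTree.Node 3 [:: formula_code cf cr c g]
  | FAnd g h =>
      GenTree.Node 4 [:: formula_code cf cr c g; formula_code cf cr c h]
  | FEx g => GenTree.Node 5 [:: formula_code cf cr (option_code c) g]
  end.

Lemma map_enum_inj (F : finType) (T : Type) (g h : F -> T) :
  [seq g i | i <- enum F] = [seq h i | i <- enum F] -> g =1 h.
Proof.
move=> gh i; have := congr1 (fun s => nth (g i) s (enum_rank i)) gh.
rewrite /= (nth_map i) -?cardE// (nth_map i) -?cardE//.
by rewrite nth_enum_rank.
Qed.

Lemma term_code_inj (L : language) (cf : Defs.fsym L -> nat) (V : Type)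
    (c : V -> nat) :
  injective cf -> injective c -> injective (term_code cf c).
Proof.
move=> icf ic; elim=> [v|f ts IH] [w|g us] //=; first by move=> [/ic ->].
(* The type of the arguments depends on the symbol, so the two symbols are identified before the
   arguments are compared. *)
move=> [/icf fg]; case: _ / fg us => us /map_enum_inj tsus.
by congr App; apply/funext => i; exact/IH/tsus.
Qed.

Lemma option_code_inj (V : Type) (c : V -> nat) :
  injective c -> injective (option_code c).
Proof. by move=> ic [v|] [w|] //= [/ic ->]. Qed.

Lemma formula_code_inj (L : language) (cf : Defs.fsym L -> nat)
    (cr : rsym L -> nat) (V : Type) (c : V -> nat) :
  injective cf -> injective cr -> injective c ->
  injective (formula_code cf cr c).
Proof.
move=> icf icr ic f; elim: f c ic => {V}
  [V|V t u|V r ts|V f IH|V f1 IH1 f2 IH2|V f IH] c ic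
  [|t' u'|r' ts'|g|g1 g2|g] //=.
- by move=> [/(term_code_inj icf ic) -> /(term_code_inj icf ic) ->].
- move=> [/icr rr']; case: _ / rr' ts' => ts' /map_enum_inj tsts'.
  by congr FRel; apply/funext => i; apply/(term_code_inj icf ic)/tsts'.
- by move=> [/(IH _ ic) ->].
- by move=> [/(IH1 _ ic) -> /(IH2 _ ic) ->].
- by move=> [/(IH _ (option_code_inj ic)) ->].
Qed.

Lemma countable_formula (L : language) (V : countType) :
  countable_language L -> countable [set: formula L V].
Proof.
move=> [/countable_injP[cf icf] /countable_injP[cr icr]]; apply/countable_injP.
exists (pickle \o formula_code cf cr pickle) => f g _ _ /=.
move/(pcan_inj pickleK)/formula_code_inj; apply; last exact: pcan_inj pickleK.
  by move=> x y; apply: icf; rewrite in_setT.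
by move=> x y; apply: icr; rewrite in_setT.
Qed.

(** * Countable unions of null sets *)

Lemma countable_bigcup_null (dd : measure_display) (T : measurableType dd)
    (R : realType) (P : probability T R) (I : Type) (F : I -> set T) :
  countable [set: I] -> (forall i, measurable (F i)) ->
  (forall i, P (F i) = 0%E) -> P (\bigcup_i F i) = 0%E.
Proof.
move=> cI mF F0.
apply: measure_negligible; first exact: countable_bigcupT_measurable.
have /countable_injP[g ig] := cI.
(* The union is reindexed by naturals: as [g] is injective, each [G n] is empty or a single
   [F i]. *)
pose G n := \bigcup_(i in [set i | g i = n]) F i.
have -> : \bigcup_i F i = \bigcup_n G n.
  apply/seteqP; split=> [x [i _ Fx]|x [n _ [i _ Fx]]]; last by exists i.
  by exists (g i) => //; exists i.
apply: negligible_bigcup => n; rewrite /G.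
have [[i gi]|no] := pselect (exists i, g i = n); last first.
  suff -> : [set i | g i = n] = set0.
    by rewrite bigcup_set0; exact: negligible_set0.
  by rewrite -subset0 => i gi; apply: no; exists i.
suff -> : [set i | g i = n] = [set i].
  by rewrite bigcup_set1; apply/(negligibleP _ (mF i)); exact: F0.
apply/seteqP; split=> [j /= gj|j ->//].
by apply: ig; rewrite ?in_setT// gi gj.
Qed.

(** * Satisfaction under renaming, measurability of clopen sets, bounds on Keisler measures *)

Section Syntax.
Context (L : language) (U : pointedType) (S : structure L U).

Lemma psat_ofL (A : set U) (V : Type) (f : formula L V) (e : V -> U) :
  psat S (ofL A f) e <-> sat S f e.
Proof. exact: sat_fmap. Qed.

Lemma psat_prename (A : set U) (V W : Type) (h : V -> W) (f : lform L A V)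
    (e : W -> U) :
  psat S (prename h f) e <-> psat S f (e \o h).
Proof.
rewrite /psat sat_fmap.
by have -> : vpair e val \o (fun v : V + A => match v with
    inl x => inl (h x) | inr a => inr a end) = vpair (e \o h) val
  by apply/funext => -[].
Qed.

Lemma psat_toU (A : set U) (V : Type) (f : lform L A V) (e : V -> U) :
  psat S (toU f) e <-> psat S f e.
Proof.
rewrite /psat sat_fmap.
by have -> : vpair e val \o (fun v : V + A => match v with
    inl x => inl x | inr a => inr (inT (val a)) end) = vpair e val
  by apply/funext => -[].
Qed.

Lemma measurable_basic (A : set U) (V : Type) (f : lform L A V) :
  measurable (basic S f : set (borel_stone S A V)).
Proof.
have obf : stone_open (basic S f) by move=> p pf; exists f.
exact: sub_sigma_algebra.
Qed.

Lemma keisler_le1 (R : realType) (A : set U) (V : Type)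
    (m : lform L A V -> R) f :
  keisler S m -> m f <= 1.
Proof.
move=> km; rewrite -(keisler1 km).
have <- : m (FOr f (FNot f)) = m FTrue.
  by apply: (keisler_ext km) => e; split=> // _ [? ?].
rewrite (keislerU km); last by move=> e [].
by rewrite lerDl (keisler_ge0 km).
Qed.

End Syntax.

(** * Half splits and the dividing-line formulas *)

Lemma card_ord_lt (n : nat) (c : bool) :
  #|[pred i : 'I_(n + n) | (i < n)%N == c]| = n.
Proof.
have lt_n : #|[pred i : 'I_(n + n) | (i < n)%N]| = n.
  rewrite -sum1_card big_split_ord /= [X in (_ + X)%N]big_pred0; last first.
    by move=> i; rewrite inE /= -[X in (_ < X)%N]addn0 ltn_add2l.
  rewrite addn0 (eq_bigl predT); last by move=> i; rewrite inE /= ltn_ord.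
  by rewrite sum1_card card_ord.
case: c.
  by rewrite -[RHS]lt_n; apply: eq_card => i; rewrite !inE eqb_id.
have := cardC [pred i : 'I_(n + n) | (i < n)%N].
rewrite lt_n card_ord => /addnI cardCn.
by rewrite -[RHS]cardCn; apply: eq_card => i; rewrite !inE eqbF_neg.
Qed.

Section HalfSplit.
Context (L : language) (U : pointedType) (S : structure L U) (d k : nat).
Context (f : formula L ('I_d + 'I_k)).

(** The boolean [c] tells which half satisfies the instance at [b]: the first if it is true, the
    second if it is false. *)
Definition half_split n (x : 'I_(n + n) * 'I_d -> U) : Prop :=
  exists (b : 'I_k -> U) (c : bool),
    forall i, sat S f (vpair (fun j => x (i, j)) b) <-> (i < n)%N = c.

Lemma sat_at_x n (W : Type) (i : 'I_n) (h : 'I_k -> W)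
    (x : 'I_n * 'I_d -> U) (b : W -> U) :
  sat S (at_x f i h) (vpair x b) <->
  sat S f (vpair (fun j => x (i, j)) (b \o h)).
Proof.
rewrite sat_fmap.
by have -> : vpair x b \o (fun v : 'I_d + 'I_k => match v with
    inl y => inl (i, y) | inr y => inr (h y) end) =
    vpair (fun j => x (i, j)) (b \o h) by apply/funext => -[].
Qed.

Lemma sat_FAlls (V : Type) (F : finType) (g : formula L (V + F)) (e : V -> U) :
  sat S (FAlls g) e <-> forall b, sat S g (vpair e b).
Proof.
rewrite /FAlls /= sat_FExs; split=> [nex b|all [b /= nb]]; last exact/nb/all.
by apply: contrapT => nb; apply: nex; exists b.
Qed.

(** With j the last index of the first half, the formula holds of x_i and y_j exactly when i <= j,
    that is, when i lies in the first half. *)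
Lemma Oform_half_split n (x : 'I_(n.+1 + n.+1) * 'I_d -> U) :
  sat S (Oform f (n.+1 + n.+1)) x -> half_split x.
Proof.
move=> /sat_FExs[b /= []] /sat_bigand ge /sat_bigand lt.
pose j : 'I_(n.+1 + n.+1) := lshift n.+1 ord_max.
exists (b \o pair j), true => i; split=> [fi|]; last first.
  by rewrite ltnS => /(ge (i, j)) /sat_at_x.
apply/negPn/negP; rewrite -leqNgt => /(lt (i, j)); apply.
exact/sat_at_x.
Qed.

(** Shattering is applied to the subset formed by the first half. *)
Lemma Iform_half_split n (x : 'I_(n + n) * 'I_d -> U) :
  sat S (Iform f (n + n)) x -> half_split x.
Proof.
move=> /sat_bigand /(_ [set i : 'I_(n + n) | (i < n)%N]%SET isT).
move=> /sat_FExs[b /= []] /sat_bigand pos /sat_bigand neg.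
exists b, true => i; split=> [fi|lt_in]; last first.
  by have /(_ _)/sat_at_x := pos i; apply; rewrite finset.inE.
apply/negPn/negP => ge_in; have /= := neg i; rewrite finset.inE => /(_ ge_in).
by apply; exact/sat_at_x.
Qed.

(** Strictness of the inclusion at the middle of the chain gives a [b] in the set of [i1] but not in
    that of [i0]. Since the sets increase, [b] lies in those of the second half only, so [c] is
    false. *)
Lemma Lform_half_split n (x : 'I_(n.+1 + n.+1) * 'I_d -> U) :
  sat S (Lform f (n.+1 + n.+1)) x -> half_split x.
Proof.
move=> /sat_bigand chain.
pose i0 : 'I_(n.+1 + n.+1) := lshift n.+1 ord_max.
pose i1 : 'I_(n.+1 + n.+1) := rshift n.+1 ord0.
have i01 : i0.+1 == i1 by rewrite /= addn0.
have [_ /sat_FExs[b [/sat_at_x fi1 nfi0]]] := chain (i0, i1) i01.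
pose sati i := sat S f (vpair (fun j => x (i, j)) b).
(* Only consecutive inclusions are given; they are composed by induction on a bound for i'. *)
have mono (i i' : 'I_(n.+1 + n.+1)) : (i <= i')%N -> sati i -> sati i'.
  move=> ii' si; have [m] := ubnP i'.
  elim: m i' ii' => // m IH i'; rewrite leq_eqVlt => /predU1P[/val_inj <- //|].
  case: i' => -[//|i'] lt_i' /=; rewrite !ltnS => ii' lt_m.
  pose p := Ordinal (ltnW lt_i').
  have sp : sati p by exact: IH.
  have [/sat_FAlls /(_ b) /= imp _] := chain (p, Ordinal lt_i') (eqxx _).
  by apply: contrapT => ns; apply: imp; split=> [|/sat_at_x//]; exact/sat_at_x.
exists b, false => i; split=> [si|/negbT]; last first.
  by rewrite -leqNgt => le_ni; apply: (mono i1) => //; rewrite /= addn0.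
apply/negbTE/negP; rewrite ltnS => le_in; have s0 := mono i i0 le_in si.
by apply: nfi0; exact/sat_at_x.
Qed.

(** * Half splits against uniform approximation by frequencies *)

Context (R : realType) (M : set U) (mu : lform L [set: U] 'I_d -> R).
Context (kmu : keisler S mu).

(** Index n stands for n+1 points, so 2(n+1) points have index [n + n.+1]. *)
Definition frequency n (a : 'I_n.+1 -> 'I_d -> U) (b : 'I_k -> U) : R :=
  #|[pred i | `[< sat S f (vpair (a i) b) >] ]|%:R / n.+1%:R.

(** A real supremum bounds its set only if the set is bounded above; here 1 is a bound, since
    measure and frequency both lie in [0,1]. *)
Lemma le_sup_deviation n (a : 'I_n.+1 -> 'I_d -> U) b :
  `|mu (inst (ofL M f) b) - frequency a b| <=
  sup [set `|mu (inst (ofL M f) b) - frequency a b| | b in [set: 'I_k -> U]].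
Proof.
apply: ub_le_sup; last by exists b.
exists 1 => _ [c _ <-].
have := keisler_ge0 kmu (inst (ofL M f) c).
have := keisler_le1 (inst (ofL M f) c) kmu.
have : 0 <= frequency a c by rewrite divr_ge0.
have : frequency a c <= 1.
  by rewrite ler_pdivrMr ?ltr0n// mul1r ler_nat -[leqRHS]card_ord max_card.
by rewrite ler_norml; lra.
Qed.

(** The frequency is 0 or 1 on the first half and 1/2 on all points. These differ by 1/2, so they
    cannot both be at distance less than 1/4 from the same value of [mu]. *)
Lemma half_split_deviation n (x : 'I_(n.+1 + n.+1) * 'I_d -> U) :
  half_split x ->
  sup [set `|mu (inst (ofL M f) b) -
      frequency (n := n) (fun i j => x (lshift n.+1 i, j)) b|
      | b in [set: 'I_k -> U]]
    < 1 / 4 ->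
  sup [set `|mu (inst (ofL M f) b) -
      frequency (n := n + n.+1) (fun i j => x (i, j)) b|
      | b in [set: 'I_k -> U]]
    < 1 / 4 -> False.
Proof.
move=> [b [c xb]].
move=> /(le_lt_trans (le_sup_deviation _ b)) +
  /(le_lt_trans (le_sup_deviation _ b)).
have -> : frequency (n := n) (fun i j => x (lshift n.+1 i, j)) b = c%:R.
  rewrite /frequency (eq_card (B := [pred i : 'I_n.+1 | c])); last first.
    by move=> i; rewrite !inE; apply/asboolP/idP; rewrite xb /= ltn_ord.
  case: c {xb}; first by rewrite eq_cardT// -cardE card_ord divff// pnatr_eq0.
  by rewrite eq_card0// mul0r.
have -> : frequency (n := n + n.+1) (fun i j => x (i, j)) b = 1 / 2.
  rewrite /frequency.
  rewrite (eq_card (B := [pred i : 'I_(n.+1 + n.+1) | (i < n.+1)%N == c]));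
    last first.
    by move=> i; rewrite !inE; apply/asboolP/eqP; rewrite xb.
  rewrite card_ord_lt -addSn natrD.
  have n0 : (0 : R) < n.+1%:R by rewrite ltr0n.
  by field; rewrite lt0r_neq0// addr_gt0.
by rewrite !ltr_norml; case: c {xb} => /=; lra.
Qed.

End HalfSplit.

(** * Nullity of the events *)

Section NullEvents.
Context (R : realType) (L : language) (K : Type) (U : pointedType).
Context (S : structure L U) (M : set U) (d : nat).
Context (mu : lform L [set: U] 'I_d -> R).
Context (P : probability (borel_stone S [set: U] (nat * 'I_d)) R).
Context (kmu : keisler S mu) (fmu : fim K S M mu) (Pmu : is_Pmu K M mu P).

Lemma half_split_event_null k (f : formula L ('I_d + 'I_k))
    (E : forall n, formula L ('I_n * 'I_d)) :
  (forall n (x : 'I_(n.+1 + n.+1) * 'I_d -> U),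
     sat S (E (n.+1 + n.+1)%N) x -> half_split S f x) ->
  P (\bigcap_(n in [set n | (0 < n)%N]) event (E n)) = 0%E.
Proof.
move=> Esplit.
have [theta [dev lim]] := fmu.2 k f.
have [|n0 n0P] := dev (1 / 4); first by lra.
pose B n := basic S (prename (fun v : 'I_n.+1 * 'I_d => (val v.1, v.2))
  (toU (theta n))) : set (borel_stone S [set: U] (nat * 'I_d)).
have mB n : measurable (B n) by exact: measurable_basic.
apply/eqP; rewrite eq_le measure_ge0 andbT; apply/lee_addgt0Pr => eps eps0.
rewrite add0e.
have : \forall n \near \oo, 1 - eps / 2 <= mpow K S M mu (toU (theta n)).
  by apply: (cvgr_ge 1 lim); lra.
(* Beyond [n0] the approximation is within 1/4, and from [n1] on the measure of theta is at least 1
   - eps/2; both apply at n and at [n + n.+1]. *)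
move=> [n1 _ n1P]; pose n := maxn n0 n1.
have PB m : (n1 <= m)%N -> (P (~` B m) <= (eps / 2)%:E)%E.
  move=> /n1P /=; rewrite probability_setC// /B Pmu.2 -EFinB lee_fin.
  by lra.
(* The event is covered by the complements of [B n] and [B (n + n.+1)], each of measure at most
   eps/2. *)
apply: (@le_trans _ _ (P (~` B n `|` ~` B (n + n.+1)))).
  apply: le_measure; rewrite ?inE.
  - by apply: bigcap_measurable => [|m _]; [exists 1%N|exact: measurable_basic].
  - by apply: measurableU; exact: measurableC.
  move=> p /(_ (n.+1 + n.+1)%N isT) pE; rewrite -setCI => -[pn pnn].
  (* A type in the event and in both sets [B] is finitely satisfiable in [U], so a single tuple [e]
     satisfies the three formulas involved; the whole type need not be realized. *)
  have [e []] := stone_sat3 pE pn pnn.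
  rewrite psat_ofL sat_fmap !psat_prename !psat_toU => /Esplit xs tn tnn.
  apply: (half_split_deviation kmu xs).
    apply: (n0P n); first by rewrite ltnS leq_maxl.
    by congr (psat S (theta n) _) : tn; apply/funext => -[].
  apply: (n0P (n + n.+1)%N).
    by rewrite ltnS (leq_trans (leq_maxl n0 n1))// leq_addr.
  by congr (psat S (theta _) _) : tnn; apply/funext => -[].
apply: (le_trans (measureU2 _ _ _)); [exact: measurableC..|].
rewrite [eps]splitr EFinD; apply: leeD; apply: PB; first exact: leq_maxr.
by rewrite (leq_trans (leq_maxr n0 n1))// leq_addr.
Qed.

(** The union runs over the length k of y and then over the formulas, both countable index sets. *)
Lemma event_union_null
    (E : forall k, formula L ('I_d + 'I_k) -> forall n, formula L ('I_n * 'I_d)) :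
  countable_language L ->
  (forall k f n (x : 'I_(n.+1 + n.+1) * 'I_d -> U),
     sat S (E k f (n.+1 + n.+1)%N) x -> half_split S f x) ->
  P (event_union E) = 0%E.
Proof.
move=> cL Esplit.
have mE k f : measurable (\bigcap_(n in [set n | (0 < n)%N]) event (E k f n)).
  by apply: bigcap_measurable => [|m _]; [exists 1%N|exact: measurable_basic].
have cF k := countable_formula ('I_d + 'I_k)%type cL.
apply: countable_bigcup_null => [|k|k]; first exact: countableP.
  by apply: countable_bigcupT_measurable => [|f]; [exact: cF|exact: mE].
apply: countable_bigcup_null => [|f|f]; [exact: cF|exact: mE|].
by apply: half_split_event_null; exact: Esplit.
Qed.

End NullEvents.

Theorem theorem6p8 (R : realType) (L : language) (T : set (sentence L))
    (K : Type) (U : pointedType) (S : structure L U) (M : set U) (d : nat)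
    (mu : lform L [set: U] 'I_d -> R)
    (P : probability (borel_stone S [set: U] (nat * 'I_d)) R) :
  countable_language L -> complete_theory T ->
  models S T -> monster K S ->
  elementary_substructure S M -> small K M ->
  keisler S mu -> M_invariant S M mu ->
  fim K S M mu ->
  is_Pmu K M mu P ->
  P (boldO S d) = 0%E /\ P (boldI S d) = 0%E /\ P (boldL S d) = 0%E.
Proof.
move=> cL _ _ _ _ _ kmu _ fmu Pmu; split; [|split].
- apply: (event_union_null kmu fmu Pmu cL) => k f n x.
  exact: Oform_half_split.
- apply: (event_union_null kmu fmu Pmu cL) => k f n x.
  exact: Iform_half_split.
- apply: (event_union_null kmu fmu Pmu cL) => k f n x.
  exact: Lform_half_split.
Qed.
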